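(* Let $G$ be a graph of order $n$ and size $m$. Then $$\psi_4(G) \leq \frac{n+3m}{10}.$$
   Context: Graphs are finite, simple and undirected. The order of $G$ is $n=|V(G)|$ and its size is $m=|E(G)|$. $P_k$ denotes the path with $k$ vertices. A $k$-path vertex cover of $G$ is a set $T\subseteq V(G)$ such that $G-T$ contains no (not necessarily induced) subgraph isomorphic to $P_k$. $\psi_k(G)$ is the minimum cardinality of a $k$-path vertex cover of $G$. *)

(* Defs.v *)
From HB Require Import structures.
From mathcomp Require Import all_boot all_order all_algebra.

Set Implicit Arguments.
Unset Strict Implicit.
Unset Printing Implicit Defensive.

Record sgraph := SGraph {
  vertex :> finType;
  adj : rel vertex;
  adj_sym : symmetric adj;
  adj_irr : irreflexive adj }.

Definition gorder (G : sgraph) : nat := #|G|.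

(* Edges are unordered pairs, so each edge is counted once in the size. *)
Definition edges (G : sgraph) : {set {set G}} :=
  [set A | [exists x : G, exists y : G, adj x y && (A == [set x; y])]].

Definition gsize (G : sgraph) : nat := #|edges G|.

Definition path_adj (k : nat) : rel 'I_k :=
  fun i j => (i.+1 == j :> nat) || (j.+1 == i :> nat).

Lemma path_adj_sym k : symmetric (@path_adj k).
Proof. by move=> i j; rewrite /path_adj orbC. Qed.

Lemma path_adj_irr k : irreflexive (@path_adj k).
Proof. by move=> i; rewrite /path_adj orbb -[X in _ == X]addn0 -addn1 eqn_add2l. Qed.

(* k is the number of vertices of the path, not of its edges. *)
Definition path_graph (k : nat) : sgraph :=
  SGraph (@path_adj_sym k) (@path_adj_irr k).

Section DeleteVertices.
Variables (G : sgraph) (T : {set G}).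

Definition del_adj : rel {x : G | x \notin T} := fun x y => adj (val x) (val y).

Lemma del_adj_sym : symmetric del_adj.
Proof. by move=> x y; apply: adj_sym. Qed.

Lemma del_adj_irr : irreflexive del_adj.
Proof. by move=> x; apply: adj_irr. Qed.

Definition del_vertices : sgraph := SGraph del_adj_sym del_adj_irr.

End DeleteVertices.

(* G has a subgraph, not necessarily induced, isomorphic to H: edges of H are
   mapped to edges of G, but non-edges of H may be mapped to edges of G. *)
Definition has_subgraph (H G : sgraph) : bool :=
  [exists f : {ffun H -> G}, injectiveb f &&
    [forall x : H, forall y : H, adj x y ==> adj (f x) (f y)]].

Definition path_vertex_cover (k : nat) (G : sgraph) (T : {set G}) : bool :=
  ~~ has_subgraph (path_graph k) (del_vertices T).

(* For k > 0 the whole vertex set is a cover, so this is a minimum over a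
   nonempty family; for k = 0 no cover exists and the value is meaningless. *)
Definition psi (k : nat) (G : sgraph) : nat :=
  #|[arg min_(T < [set: G] | path_vertex_cover k T) #|T|]|.

Lemma path_vertex_coverT (k : nat) (G : sgraph) :
  0 < k -> path_vertex_cover k [set: G].
Proof.
case: k => // k _; apply/negP => /existsP[f _].
by have := valP (f (ord0 : 'I_k.+1)); rewrite /= inE.
Qed.

Lemma psiP (k : nat) (G : sgraph) : 0 < k ->
  (exists2 T : {set G}, path_vertex_cover k T & #|T| = psi k G) /\
  (forall T : {set G}, path_vertex_cover k T -> psi k G <= #|T|).
Proof.
move=> k_gt0; rewrite /psi.
case: arg_minnP => [|T covT minT]; first exact: path_vertex_coverT.
by split=> //; exists T.
Qed.

(* Main.v *)
Require Import Defs.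
From mathcomp Require Import all_boot all_order all_algebra.
From mathcomp Require Import zify.

Set Implicit Arguments.
Unset Strict Implicit.
Unset Printing Implicit Defensive.

(** The proof is an induction over induced subgraphs, for the bound
    [10 |T| <= weight S = |S| + 3 e(S)], where [e(S)] counts the edges inside
    [S].  A step puts a few vertices [A] into the cover and discards [A] together
    with a set [K] of at most three vertices that [A] separates from the rest of
    [S]: no path on four vertices avoiding [A] can meet [K].  The step is
    affordable as soon as the weight drops by at least [10 |A|]
    ([separate_step]).

    A vertex of degree at least three pays for itself, since [1 + 3 * 3 = 10]
    ([high_degree_step]).  Once all degrees are at most two, the inner vertices
    of a path a b c d have no further neighbours.  If all neighbours of a are
    among b and d, then [A = {d}] cuts off [K = {a, b, c}], and the weight drops
    by at least [4 + 3 * 3 = 13] ([dead_end_step]).  Otherwise a has a new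
    neighbour e.  Either the path e a b c has a dead end at e in the same sense,
    or e has a neighbour f outside {a, c}; then [A = {e, d}] cuts off
    [K = {a, b, c}] and destroys the five edges fe, ea, ab, bc, cd, so that the
    weight drops by at least [5 + 3 * 5 = 20] ([path5_step]).  The case [f = d]
    is included; it is the five-cycle, for which the bound is attained. *)

Section InducedSubgraphs.
Variable G : sgraph.
Implicit Types (S T A K : {set G}) (a b c d e v w : G).

Definition nbrs S v : {set G} := [set w in S | adj v w].

Definition edges_in S : {set {set G}} := [set F in edges G | F \subset S].

Definition weight S : nat := #|S| + 3 * #|edges_in S|.

Definition path4 S a b c d : bool :=
  [&& uniq [:: a; b; c; d], all (mem S) [:: a; b; c; d],
      adj a b, adj b c & adj c d].

Definition path4_free S : Prop := forall a b c d, ~~ path4 S a b c d.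

Definition has_cheap_cover S : Prop :=
  exists2 T, path4_free (S :\: T) & 10 * #|T| <= weight S.

Lemma edges_in_setD1 S v :
  v \in S -> #|edges_in (S :\ v)| + #|nbrs S v| <= #|edges_in S|.
Proof.
move=> vS.
have inj : {in nbrs S v &, injective (fun w => [set v; w])}.
  move=> w w'; rewrite !inE => /andP[_ vw] /andP[_ vw'] /setP/(_ w).
  rewrite !inE eqxx orbT; case: eqP => [wv|_ /esym/eqP //].
  by rewrite -wv adj_irr in vw.
rewrite -(card_in_imset inj) -cardsUI.
have -> : edges_in (S :\ v) :&: [set [set v; w] | w in nbrs S v] = set0.
  apply/setP=> F; rewrite !inE; apply/negP=> /andP[/andP[_ FS]].
  case/imsetP=> w _ EF; move/subsetP/(_ v): FS.
  by rewrite EF !inE eqxx => /(_ isT).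
rewrite cards0 addn0; apply/subset_leq_card/subsetP=> F.
rewrite inE => /orP[|/imsetP[w wN ->]].
  by rewrite !inE => /andP[-> /=]; rewrite subsetD1 => /andP[].
move: wN; rewrite !inE => /andP[wS vw]; apply/andP; split.
  by apply/existsP; exists v; apply/existsP; exists w; rewrite vw eqxx.
by apply/subsetP=> x; rewrite !inE => /orP[] /eqP->.
Qed.

Lemma nbrs_card2 S v a b :
  #|nbrs S v| <= 2 -> a != b -> a \in nbrs S v -> b \in nbrs S v ->
  nbrs S v = [set a; b].
Proof.
move=> le2 ab aN bN; apply/esym/eqP; rewrite eqEcard cards2 ab le2 andbT.
by apply/subsetP=> x /set2P[] ->.
Qed.

(** A path that avoids [A] and meets [K] stays inside [K], because [K] is closed
    under adjacency once [A] is gone; but four vertices do not fit in [K]. *)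
Lemma separate_step S A K :
  #|K| <= 3 ->
  (forall x y, x \in K -> y \in nbrs S x -> (y \in A) || (y \in K)) ->
  10 * #|A| + weight (S :\: (A :|: K)) <= weight S ->
  has_cheap_cover (S :\: (A :|: K)) -> has_cheap_cover S.
Proof.
move=> K3 closed budget [T free bound]; exists (A :|: T); last first.
  apply: leq_trans budget; apply: leq_trans (leq_add (leqnn _) bound).
  by rewrite -mulnDr leq_mul2l leq_card_setU.
move=> a b c d; apply/negP=> /and5P[U /= inS ab bc cd].
have [aS bS cS dS] : [/\ a \in S :\: (A :|: T), b \in S :\: (A :|: T),
  c \in S :\: (A :|: T) & d \in S :\: (A :|: T)] by case/and5P: inS.
have stay x y : x \in S :\: (A :|: T) -> y \in S :\: (A :|: T) -> adj x y ->
    (x \in K) = (y \in K).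
  rewrite !inE !negb_or => /andP[/andP[xA _] xS] /andP[/andP[yA _] yS] xy.
  apply/idP/idP=> [xK | yK].
    by have := closed x y xK; rewrite !inE yS xy (negPf yA); apply.
  by have := closed y x yK; rewrite !inE xS adj_sym xy (negPf xA); apply.
have Eab := stay _ _ aS bS ab; have Ebc := stay _ _ bS cS bc.
have Ecd := stay _ _ cS dS cd.
case: (boolP (a \in K)) => [aK | aK].
  have : size [:: a; b; c; d] <= #|K|.
    rewrite -(card_uniqP U); apply/subset_leq_card/subsetP=> x.
    by rewrite !inE => /or4P[] /eqP->; rewrite -?Ecd -?Ebc -?Eab.
  by move=> /= /leq_trans/(_ K3).
have out x : x \in S :\: (A :|: T) -> x \notin K ->
    x \in S :\: (A :|: K) :\: T.
  by rewrite !inE !negb_or => /andP[/andP[-> ->] ->] ->.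
have [bK cK dK] : [/\ b \notin K, c \notin K & d \notin K].
  by rewrite -Ecd -Ebc -Eab.
by move: (free a b c d); rewrite /path4 U ab bc cd /= !out.
Qed.

(** Bookkeeping for lower bounds on the drop in weight.  Vertices are removed one
    at a time and [k] only bounds the degree within what is left, so no edge is
    counted twice; [n] is the drop still to be accounted for, and becomes 0 once
    enough vertices and edges are gone. *)
Lemma remove_vertex S v k n x : v \in S -> k <= #|nbrs S v| ->
  n - (1 + 3 * k) + x <= weight (S :\ v) -> n + x <= weight S.
Proof.
move=> vS kN; have := edges_in_setD1 vS.
rewrite /weight (cardsD1 v S) vS; move: kN.
move: #|nbrs S v| #|edges_in S| #|edges_in (S :\ v)| #|S :\ v|; clear; lia.
Qed.

Lemma high_degree_step S v :
  v \in S -> 3 <= #|nbrs S v| -> has_cheap_cover (S :\ v) -> has_cheap_cover S.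
Proof.
move=> vS deg IH; apply: (@separate_step S [set v] set0).
- by rewrite cards0.
- by move=> x y; rewrite in_set0.
- by rewrite setU0 cards1; apply: (remove_vertex vS deg).
- by rewrite setU0.
Qed.

Lemma card_set3_le a b c : #|[set a; b; c]| <= 3.
Proof. by rewrite setUC cardsU1 cards2; case: (_ \notin _); case: (_ != _). Qed.

Section MaximumDegreeTwo.
Variable S : {set G}.
Hypothesis max_deg2 : forall v, v \in S -> #|nbrs S v| <= 2.
Hypothesis IH : forall R : {set G}, R \proper S -> has_cheap_cover R.

Lemma path4_inner a b c d : path4 S a b c d ->
  nbrs S b = [set a; c] /\ nbrs S c = [set b; d].
Proof.
rewrite /path4 /= !inE !negb_or.
case/and5P=> /and4P[/and3P[ab' ac' ad'] /andP[bc' bd'] cd' _].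
case/and5P=> aS bS cS dS _ ab bc cd.
split; apply: nbrs_card2; rewrite ?max_deg2 ?inE //.
- by rewrite aS adj_sym.
- by rewrite cS.
- by rewrite bS adj_sym.
- by rewrite dS.
Qed.

(** The only way out of [{a, b, c}] is through d, possibly also from a, so covering
    d turns it into a whole component. *)
Lemma dead_end_step a b c d : path4 S a b c d ->
  nbrs S a \subset [set b; d] -> has_cheap_cover S.
Proof.
move=> P Na; have [Nb Nc] := path4_inner P; move: P.
rewrite /path4 /= !inE !negb_or.
case/and5P=> /and4P[/and3P[ab' ac' ad'] /andP[bc' bd'] cd' _].
case/and5P=> aS bS cS dS _ ab bc cd.
have ER : S :\: ([set d] :|: [set a; b; c]) = S :\ b :\ c :\ a :\ d.
  apply/setP=> x; rewrite !inE.
  by case: (x == a) (x == b) (x == c) (x == d) => [] [] [] [].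
apply: (@separate_step S [set d] [set a; b; c]); rewrite ?ER.
- exact: card_set3_le.
- move=> x y; rewrite [x \in _]inE [x \in _]inE !in_set1 -orbA.
  case/or3P=> /eqP->; rewrite ?Nb ?Nc => yN.
  + by move/subsetP/(_ y yN): Na; rewrite !inE => /orP[] ->; rewrite ?orbT.
  + by move: yN; rewrite !inE => /orP[] ->; rewrite ?orbT.
  + by move: yN; rewrite !inE => /orP[] ->; rewrite ?orbT.
- rewrite cards1.
  (* b takes two edges with it, then c one more *)
  apply: (@remove_vertex _ b 2) => //; first by rewrite Nb cards2 ac'.
  apply: (@remove_vertex _ c 1); first by rewrite !inE eq_sym bc'.
    by apply/card_gt0P; exists d; rewrite !inE dS cd eq_sym bd'.
  apply: (@remove_vertex _ a 0) => //; first by rewrite !inE ab' ac'.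
  apply: (@remove_vertex _ d 0) => //.
  by rewrite !inE dS eq_sym ad' eq_sym cd' eq_sym bd'.
- by apply: IH; rewrite -ER properE subsetDl; apply/subsetPn; exists d;
    rewrite // !inE eqxx.
Qed.

(** The path e a b c d shows only four edges, for a drop of 17 where two covered
    vertices cost 20; the edge ef, which the removal of a and c leaves in place,
    makes up the missing 3. *)
Lemma path5_step a b c d e f : path4 S a b c d -> path4 S e a b c ->
  e != d -> f \in nbrs S e -> f \notin [set a; c] -> has_cheap_cover S.
Proof.
move=> P Q ed' fN fac; have [Nb Nc] := path4_inner P.
have [Na _] := path4_inner Q; move: P Q.
rewrite /path4 /= !inE !negb_or.
case/and5P=> /and4P[/and3P[ab' ac' ad'] /andP[bc' bd'] cd' _].
case/and5P=> aS bS cS dS _ ab bc cd.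
case/and5P=> /and4P[/and3P[ea' eb' ec'] _ _ _] /and5P[eS _ _ _ _] ea _ _.
have ER : S :\: ([set e; d] :|: [set a; b; c]) = S :\ a :\ c :\ e :\ b :\ d.
  apply/setP=> x; rewrite !inE.
  by case: (x == a) (x == b) (x == c) (x == d) (x == e) => [] [] [] [] [].
apply: (@separate_step S [set e; d] [set a; b; c]); rewrite ?ER.
- exact: card_set3_le.
- move=> x y; rewrite [x \in _]inE [x \in _]inE !in_set1 -orbA.
  by case/or3P=> /eqP->; rewrite ?Na ?Nb ?Nc !inE => /orP[] ->; rewrite ?orbT.
- rewrite cards2 ed'.
  (* a and c are not adjacent and take two edges each; ef then survives *)
  apply: (@remove_vertex _ a 2) => //; first by rewrite Na cards2 eb'.
  apply: (@remove_vertex _ c 2); first by rewrite !inE eq_sym ac'.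
    have := cards2 b d; rewrite bd' => <-; apply/subset_leq_card/subsetP=> x.
    case/set2P=> ->; first by rewrite !inE bS adj_sym bc eq_sym ab'.
    by rewrite !inE dS cd eq_sym ad'.
  apply: (@remove_vertex _ e 1); first by rewrite !inE ea' ec'.
    apply/card_gt0P; exists f; move: fN fac.
    by rewrite !inE negb_or => /andP[-> ->] /andP[-> ->].
  apply: (@remove_vertex _ b 0) => //.
    by rewrite !inE bS bc' eq_sym eb' eq_sym ab'.
  apply: (@remove_vertex _ d 0) => //.
  by rewrite !inE dS eq_sym bd' eq_sym ed' eq_sym cd' eq_sym ad'.
- by apply: IH; rewrite -ER properE subsetDl; apply/subsetPn; exists d;
    rewrite // !inE eqxx !orbT.
Qed.

Lemma max_degree2_step a b c d : path4 S a b c d -> has_cheap_cover S.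
Proof.
move=> P; case: (boolP (nbrs S a \subset [set b; d])) => [|/subsetPn[e eN ebd]].
  exact: dead_end_step P.
have [eb' ed'] : e != b /\ e != d by apply/andP; move: ebd; rewrite !inE negb_or.
have Q : path4 S e a b c.
  have [_ Nc] := path4_inner P; move: P eN; rewrite /path4 /= !inE !negb_or.
  case/and5P=> /and4P[/and3P[ab' ac' ad'] /andP[bc' bd'] cd' _].
  case/and5P=> aS bS cS dS _ ab bc cd /andP[eS ae].
  rewrite eS aS bS cS ab' ac' bc' ab bc eb' (adj_sym e a) ae !andbT /=.
  (* [e] differs from [c], whose two neighbours [b] and [d] are not [a] *)
  apply/andP; split; apply/eqP=> E; first by rewrite E adj_irr in ae.
  by move/setP/(_ a): Nc; rewrite !inE -E aS adj_sym ae (negPf ab') (negPf ad').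
case: (boolP (nbrs S e \subset [set a; c])) => [|/subsetPn[f fN fac]].
  exact: dead_end_step Q.
exact: path5_step P Q ed' fN fac.
Qed.

End MaximumDegreeTwo.

Lemma cheap_cover S : has_cheap_cover S.
Proof.
have [n] := ubnP #|S|; elim: n S => // n IHn S ltSn.
have IH (R : {set G}) : R \proper S -> has_cheap_cover R.
  by move/proper_card=> ltR; apply: IHn; lia.
case: (boolP [exists v in S, 2 < #|nbrs S v|]) => [/exists_inP[v vS deg]|].
  exact: high_degree_step vS deg (IH _ (properD1 vS)).
rewrite negb_exists_in => /forall_inP small.
have max_deg2 v : v \in S -> #|nbrs S v| <= 2.
  by move=> vS; rewrite leqNgt small.
case: (boolP [exists a, exists b, exists c, exists d, path4 S a b c d]).
  case/existsP=> a /existsP[b /existsP[c /existsP[d]]].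
  exact: max_degree2_step.
move=> free; exists set0; last by rewrite cards0.
move=> a b c d; rewrite setD0; apply: contra free => P.
by do 4! [apply/existsP; eexists]; exact: P.
Qed.

Lemma path4_free_cover T : path4_free (~: T) -> path_vertex_cover 4 T.
Proof.
move=> free; apply/negP=> /existsP[f /andP[/injectiveP injf /forallP hom]].
pose g i : G := val (f (inord i : 'I_4)).
have gS i : g i \in ~: T by rewrite inE; exact: (valP (f (inord i))).
have g_neq i j : i < 4 -> j < 4 -> i != j -> g i != g j.
  move=> i4 j4; apply: contra => /eqP/val_inj/injf E.
  by rewrite -(inordK i4) -(inordK j4) E.
have g_adj i : i.+1 < 4 -> adj (g i) (g i.+1).
  move=> i4; have /forallP/(_ (inord i.+1))/implyP := hom (inord i); apply.
  by rewrite /= /path_adj !inordK ?eqxx // ltnW.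
move: (free (g 0) (g 1) (g 2) (g 3)); rewrite /path4 /= !inE !negb_or.
rewrite !g_adj // !g_neq //; move: (gS 0) (gS 1) (gS 2) (gS 3).
by rewrite !inE => -> -> -> ->.
Qed.

End InducedSubgraphs.

Theorem theorem9 (G : sgraph) :
  ((psi 4 G)%:R <= ((gorder G)%:R + 3 * (gsize G)%:R) / 10 :> rat)%R.
Proof.
have [T free bound] := cheap_cover [set: G].
have [_ psi_min] := psiP G (isT : 0 < 4).
have psiT : psi 4 G <= #|T|.
  by apply/psi_min/path4_free_cover; rewrite -setTD.
have sizeG : #|edges_in [set: G]| <= gsize G.
  by apply/subset_leq_card/subsetP=> F; rewrite inE => /andP[].
rewrite /weight cardsT in bound.
rewrite Num.Theory.ler_pdivlMr // -!GRing.natrM -GRing.natrD Num.Theory.ler_nat.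
by rewrite /gorder; lia.
Qed.
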